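(* The inclusion $B_{1} \subseteq B_{3}^{m}$ holds, i.e. every graph that has an EPG representation in which each path has at most one bend also has an EPG representation in which each path is monotonic and has at most three bends.
   Context: All graphs are finite and simple. A grid consists of horizontal grid lines (rows, increasing from bottom to top) and vertical grid lines (columns, increasing from left to right). A grid point is a crossing of two grid lines. A grid edge is the part of a grid line between two consecutive grid points. A path on a grid consists of two grid points (its end points) and a number of consecutive grid edges connecting them. A bend of a path is a turn of the path at a grid point. An EPG representation of a graph $G$ assigns to each vertex $v$ of $G$ a path $P_v$ on a common grid such that two distinct vertices $v,w$ are adjacent in $G$ if and only if $P_v$ and $P_w$ share at least one grid edge. A path is monotonic if it is ascending in both columns and rows, i.e. it has the shape of a staircase going upwards from left to right. For a nonnegative integer $k$, $B_k$ is the class of all graphs that have an EPG representation in which every path has at most $k$ bends, and $B_k^m$ (the superscript $m$ is just a symbol for ''monotonic'') is the class of all graphs that have an EPG representation in which every path is monotonic and has at most $k$ bends. *)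

(* Defs.v *)
From mathcomp Require Import all_boot.

Set Implicit Arguments.
Unset Strict Implicit.
Unset Printing Implicit Defensive.

Record sgraph := SGraph {
  vertex :> finType;
  adj : rel vertex;
  adj_sym : symmetric adj;
  adj_irrefl : irreflexive adj
}.

(* (i, j) is the crossing of the i-th column, counted from the left, and the  *)
(* j-th row, counted from the bottom.                                         *)
Definition point := (nat * nat)%type.

Definition grid_point (c r : nat) (a : point) : bool := (a.1 < c) && (a.2 < r).

Definition grid_adj (a b : point) : bool :=
  (a.2 == b.2) && ((a.1.+1 == b.1) || (b.1.+1 == a.1)) ||
  (a.1 == b.1) && ((a.2.+1 == b.2) || (b.2.+1 == a.2)).

(* A path is given by the sequence of the grid points it visits, in one of    *)
(* its two orientations. Paths do not visit a point twice, and they have two  *)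
(* distinct end points.                                                       *)
Definition grid_path (c r : nat) (p : seq point) : bool :=
  [&& 1 < size p, uniq p, all (grid_point c r) p & sorted grid_adj p].

(* Each edge is listed in both orientations, so that sharing an edge does not *)
(* depend on the directions in which the paths are traversed.                 *)
Definition path_edges (p : seq point) : seq (point * point) :=
  zip p (behead p) ++ zip (behead p) p.

Definition share_edge (p q : seq point) : bool :=
  has [in path_edges p] (path_edges q).

(* Exactly one of the two successive steps is horizontal. *)
Definition turn (a b c : point) : bool := (a.2 == b.2) != (b.2 == c.2).

Fixpoint bends (p : seq point) : nat :=
  if p is a :: q then
    (if q is b :: c :: _ then nat_of_bool (turn a b c) else 0) + bends q
  else 0.

Definition ascending (p : seq point) : bool :=
  sorted (fun a b : point => (a.1 <= b.1) && (a.2 <= b.2)) p.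

Definition monotonic (p : seq point) : bool := ascending p || ascending (rev p).

Definition EPG_representation (G : sgraph) (c r : nat) (P : G -> seq point) :
    Prop :=
  (forall v, grid_path c r (P v)) /\
  (forall v w, v != w -> adj v w = share_edge (P v) (P w)).

Definition B (k : nat) (G : sgraph) : Prop :=
  exists (c r : nat) (P : G -> seq point),
    EPG_representation c r P /\ forall v, bends (P v) <= k.

Definition Bm (k : nat) (G : sgraph) : Prop :=
  exists (c r : nat) (P : G -> seq point),
    EPG_representation c r P /\ forall v, monotonic (P v) /\ bends (P v) <= k.

(* Main.v *)
Require Import Defs.
From mathcomp Require Import all_boot.
From mathcomp Require Import zify.

(* The edges of a path with at most one bend form an interval of one row and  *)
(* an interval of one column. Only these intervals matter for adjacency, so   *)
(* the rows may be drawn in the lower left corner of a new grid and the       *)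
(* columns in its upper right corner. After a perturbation the right ends of  *)
(* the row intervals are distinct, and so are the lower ends of the column    *)
(* intervals. Then the right end of the row interval of a vertex is joined to *)
(* the lower end of its column interval by going up and then right along grid *)
(* lines that no other connection uses: a staircase with three bends.         *)

(** Sharing an edge means sharing a horizontal or a vertical unit edge ([share_edgeP]), so a path
    with at most one bend can be replaced by one half-open interval on a row and one on a column
    ([one_bend_edges]), which [nonempty_intervals] makes nondegenerate. Adjacency now says that the
    row intervals or the column intervals overlap. In the new drawing, old rows lie below all
    connecting rows and old columns lie to the right of all connecting columns. Each connecting line
    is private to one vertex, so no adjacency is created ([Bm3_of_distinct_ends]);
    [Bm3_of_intervals] obtains this privacy by scaling. *)

Lemma mem_path_edges_cons (e : point * point) a b p :
  (e \in path_edges [:: a, b & p]) =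
  [|| e == (a, b), e == (b, a) | e \in path_edges (b :: p)].
Proof.
rewrite /path_edges /= !inE !mem_cat !inE.
by case: (e == (a, b)) => //=; rewrite orbCA.
Qed.

Lemma mem_path_edges1 (e : point * point) a : (e \in path_edges [:: a]) = false.
Proof. by []. Qed.

Lemma path_edges_sym a b p : ((a, b) \in path_edges p) = ((b, a) \in path_edges p).
Proof.
case: p => // c p; elim: p c => [|d p IHp] c //.
rewrite !mem_path_edges_cons IHp !xpair_eqE (andbC (b == c)) (andbC (b == d)).
by rewrite orbCA.
Qed.

Lemma grid_adj_sym : symmetric grid_adj.
Proof. by move=> [x y] [x' y']; rewrite /grid_adj /=; lia. Qed.

Lemma path_edges_adj a b p :
  sorted grid_adj p -> (a, b) \in path_edges p -> grid_adj a b.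
Proof.
case: p => // c p; elim: p c => [|d p IHp] c // /andP[cd dp].
rewrite mem_path_edges_cons => /or3P[/eqP[-> ->]//|/eqP[-> ->]|].
  by rewrite grid_adj_sym.
exact: IHp.
Qed.

Definition hedge p x y := ((x, y), (x.+1, y)) \in path_edges p.

Definition vedge p x y := ((x, y), (x, y.+1)) \in path_edges p.

Lemma share_edgeP p q : sorted grid_adj q ->
  reflect (exists x y, hedge p x y && hedge q x y || vedge p x y && vedge q x y)
          (share_edge p q).
Proof.
move=> q_path; apply: (iffP hasP) => [[[[x y] [x' y']] eq ep]|[x [y /orP[]]]].
- have := path_edges_adj _ _ _ q_path eq.
  have {}ep : ((x, y), (x', y')) \in path_edges p by exact: ep.
  rewrite /grid_adj /hedge /vedge /=.
  case/orP=> /andP[/eqP e1 /orP[]/eqP e2]; subst.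
  + by exists x, y'; rewrite ep eq.
  + by rewrite path_edges_sym in ep; rewrite path_edges_sym in eq;
      exists x', y'; rewrite ep eq.
  + by exists x', y; rewrite ep eq orbT.
  + by rewrite path_edges_sym in ep; rewrite path_edges_sym in eq;
      exists x', y'; rewrite ep eq orbT.
- by move=> /andP[hp hq]; exists ((x, y), (x.+1, y)).
- by move=> /andP[hp hq]; exists ((x, y), (x, y.+1)).
Qed.

(** For a horizontal step the range from [minn] to [maxn] contains a single number; writing it as a
    range prepares the merging of edges into intervals. *)
Lemma hedge_cons a b p x y : grid_adj a b ->
  hedge [:: a, b & p] x y =
  (a.2 == b.2) && ((y == a.2) && (minn a.1 b.1 <= x < maxn a.1 b.1))
  || hedge (b :: p) x y.
Proof.
rewrite /hedge mem_path_edges_cons orbA => ab; congr (_ || _).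
by case: a b ab => [x1 y1] [x2 y2]; rewrite /grid_adj !xpair_eqE /=; lia.
Qed.

Lemma vedge_cons a b p x y : grid_adj a b ->
  vedge [:: a, b & p] x y =
  (a.2 != b.2) && ((x == a.1) && (minn a.2 b.2 <= y < maxn a.2 b.2))
  || vedge (b :: p) x y.
Proof.
rewrite /vedge mem_path_edges_cons orbA => ab; congr (_ || _).
by case: a b ab => [x1 y1] [x2 y2]; rewrite /grid_adj !xpair_eqE /=; lia.
Qed.

(** * Edge sets of paths with at most one bend *)

(* A straight walk whose first step goes from [x1] to [x2] covers [l, r].      *)
Definition starts_interval x1 x2 l r :=
  l < r /\ (x2 = x1.+1 /\ l = x1 \/ x1 = x2.+1 /\ r = x1).

Lemma starts_interval1 x1 x2 : x2 = x1.+1 \/ x1 = x2.+1 ->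
  starts_interval x1 x2 (minn x1 x2) (maxn x1 x2).
Proof. by rewrite /starts_interval; lia. Qed.

(** Since [x1 <> x3] excludes turning back, the new edge is attached at the end of the interval
    where the walk starts. *)
Lemma starts_interval_extend x1 x2 x3 l r :
  x2 = x1.+1 \/ x1 = x2.+1 -> x1 <> x3 -> starts_interval x2 x3 l r ->
  starts_interval x1 x2 (minn x1 l) (maxn x1 r) /\
  forall x, (minn x1 x2 <= x < maxn x1 x2) || (l <= x < r) =
            (minn x1 l <= x < maxn x1 r).
Proof.
rewrite /starts_interval => e12 ne [lr e23].
by split=> [|x]; lia.
Qed.

(* The last conjunct locates the first edge of the path at an end of its      *)
(* interval, so that the interval can be extended by one more edge.           *)
Lemma one_bend_edges_from a b p :
  path grid_adj a (b :: p) -> uniq [:: a, b & p] -> bends [:: a, b & p] <= 1 ->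
  exists row l r col d u : nat,
    [/\ forall x y, hedge [:: a, b & p] x y = (y == row) && (l <= x < r),
        forall x y, vedge [:: a, b & p] x y = (x == col) && (d <= y < u) &
        if a.2 == b.2
        then [/\ row = a.2, starts_interval a.1 b.1 l r
               & bends [:: a, b & p] = 0 -> u <= d]
        else [/\ col = a.1, starts_interval a.2 b.2 d u
               & bends [:: a, b & p] = 0 -> r <= l]].
Proof.
elim: p a b => [|c p IHp] a b.
  move=> /andP[adj_ab _] _ _; have [eq_y|ne_y] := eqVneq a.2 b.2.
    (* The zeros are a dummy empty interval for the direction that does not occur. *)
    exists a.2, (minn a.1 b.1), (maxn a.1 b.1), 0, 0, 0; split=> [x y|x y|].
    - by rewrite hedge_cons // eq_y eqxx orbF.
    - by rewrite vedge_cons // eq_y eqxx andbF.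
    - split=> //; apply: starts_interval1; move: adj_ab; rewrite /grid_adj; lia.
  exists 0, 0, 0, a.1, (minn a.2 b.2), (maxn a.2 b.2); split=> [x y|x y|].
  - by rewrite hedge_cons // (negPf ne_y) andbF.
  - by rewrite vedge_cons // ne_y orbF.
  - split=> //; apply: starts_interval1; move: adj_ab; rewrite /grid_adj; lia.
move=> /andP[adj_ab path_bc] /andP[a_bcp uniq_bc].
have ne_ac : ~ (a.1 = c.1 /\ a.2 = c.2).
  case: a c a_bcp {adj_ab path_bc uniq_bc} => [x1 y1] [x3 y3] /= a_bcp [e1 e2].
  by move: a_bcp; rewrite e1 e2 !inE eqxx orbT.
have -> : bends [:: a, b, c & p] = turn a b c + bends [:: b, c & p] by [].
rewrite /turn => bends_p.
have [//|//||row [l [r [col [d [u [hE vE]]]]]]] := IHp b c.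
  exact: leq_trans (leq_addl _ _) bends_p.
move: bends_p.
case: (eqVneq b.2 c.2) => [eq_bc|ne_bc]; case: (eqVneq a.2 b.2) => [eq_ab|ne_ab];
  move=> bends_p [line_eq start flat].
- have [||start' ext] := starts_interval_extend a.1 b.1 c.1 l r _ _ start.
  + by move: adj_ab; rewrite /grid_adj; lia.
  + by lia.
  exists row, (minn a.1 l), (maxn a.1 r), col, d, u; split=> [x y|x y|].
  + by rewrite hedge_cons // hE eq_ab eqxx line_eq andTb -andb_orr ext.
  + by rewrite vedge_cons // vE eq_ab eqxx.
  + by rewrite eq_ab.
(* The turn at [b] uses up the only bend, so the rest is straight: its vertical interval is empty
   and the first edge can take its place. *)
- have {}flat : u <= d by apply: flat; apply/eqP; rewrite -leqn0 -ltnS -add1n.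
  exists row, l, r, a.1, (minn a.2 b.2), (maxn a.2 b.2); split=> [x y|x y|].
  + by rewrite hedge_cons // hE (negPf ne_ab).
  + rewrite vedge_cons // vE ne_ab; lia.
  + split=> //; apply: starts_interval1; move: adj_ab; rewrite /grid_adj; lia.
- have {}flat : r <= l by apply: flat; apply/eqP; rewrite -leqn0 -ltnS -add1n.
  exists a.2, (minn a.1 b.1), (maxn a.1 b.1), col, d, u; split=> [x y|x y|].
  + rewrite hedge_cons // hE eq_ab eqxx; lia.
  + by rewrite vedge_cons // vE eq_ab eqxx.
  + split=> //; apply: starts_interval1; move: adj_ab; rewrite /grid_adj; lia.
- have [||start' ext] := starts_interval_extend a.2 b.2 c.2 d u _ _ start.
  + by move: adj_ab; rewrite /grid_adj; lia.
  + by case/andP: path_bc adj_ab => adj_bc _; move: adj_bc; rewrite /grid_adj; lia.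
  have eq_col : a.1 = b.1 by move: adj_ab; rewrite /grid_adj; lia.
  exists row, l, r, col, (minn a.2 d), (maxn a.2 u); split=> [x y|x y|].
  + by rewrite hedge_cons // hE (negPf ne_ab).
  + by rewrite vedge_cons // vE ne_ab eq_col line_eq andTb -andb_orr ext.
  + by rewrite eq_col.
Qed.

Lemma one_bend_edges c r p : grid_path c r p -> bends p <= 1 ->
  exists h v : nat * (nat * nat),
    (forall x y, hedge p x y = (y == h.1) && (h.2.1 <= x < h.2.2)) /\
    (forall x y, vedge p x y = (x == v.1) && (v.2.1 <= y < v.2.2)).
Proof.
case: p => [|a [|b p]] // /and4P[_ up _ sp] bp.
have [row [l [r' [col [d [u [hE vE _]]]]]]] := one_bend_edges_from a b p sp up bp.
by exists (row, (l, r')), (col, (d, u)).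
Qed.

(** * Staircase paths *)

Definition step (p q : point) : bool :=
  (p.2 == q.2) && (p.1.+1 == q.1) || (p.1 == q.1) && (p.2.+1 == q.2).

Definition hrun y x n : seq point := [seq (i, y) | i <- iota x n].

Definition vrun x y n : seq point := [seq (x, j) | j <- iota y n].

Lemma mem_hrun y x n (p : point) :
  (p \in hrun y x n) = (p.2 == y) && (x <= p.1 < x + n).
Proof.
case: p => i j /=; apply/mapP/idP => [[k]|/andP[/eqP-> lei]].
  by rewrite mem_iota => lek [-> ->]; rewrite eqxx.
by exists i; rewrite ?mem_iota.
Qed.

Lemma mem_vrun x y n (p : point) :
  (p \in vrun x y n) = (p.1 == x) && (y <= p.2 < y + n).
Proof.
case: p => i j /=; apply/mapP/idP => [[k]|/andP[/eqP-> lej]].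
  by rewrite mem_iota => lek [-> ->]; rewrite eqxx.
by exists j; rewrite ?mem_iota.
Qed.

Lemma last_hrun y x n : last (x, y) (hrun y x.+1 n) = (x + n, y).
Proof. by elim: n x => [|n IHn] x; rewrite /= ?addn0 // [last _ _]IHn addSnnS. Qed.

Lemma last_vrun x y n : last (x, y) (vrun x y.+1 n) = (x, y + n).
Proof. by elim: n y => [|n IHn] y; rewrite /= ?addn0 // [last _ _]IHn addSnnS. Qed.

Lemma path_hrun y x n : path step (x, y) (hrun y x.+1 n).
Proof. by elim: n x => //= n IHn x; rewrite [path _ _ _]IHn /step /= !eqxx. Qed.

Lemma path_vrun x y n : path step (x, y) (vrun x y.+1 n).
Proof. by elim: n y => //= n IHn y; rewrite [path _ _ _]IHn /step /= !eqxx orbT. Qed.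

Lemma bends_hrun y x n : bends (hrun y x n) = 0.
Proof.
elim: n x => //= n IHn x; rewrite [bends (map _ _)]IHn addn0.
by case: n {IHn} => [|[|n]] //=; rewrite /turn /= !eqxx.
Qed.

Lemma bends_vrun x y n : bends (vrun x y n) = 0.
Proof.
elim: n y => //= n IHn y; rewrite [bends (map _ _)]IHn addn0.
by case: n {IHn} => [|[|n]] //=; rewrite /turn /= !ltn_eqF.
Qed.

(** The pieces share the junction [last a p]; only the triple centred there can lie in neither
    piece, hence the extra one. *)
Lemma bends_cat a p q :
  bends (a :: p ++ q) <= bends (a :: p) + (bends (last a p :: q)).+1.
Proof.
elim: p a => [|b p IHp] a; first by rewrite /= add0n leqnSn.
have := IHp b; case: p {IHp} => [|c p] /= IHp; last by rewrite -addnA leq_add2l.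
case: q IHp => [|c q] //= _; by case: (turn a b c).
Qed.

Section StepPaths.

Variables (p : seq point) (p_step : sorted step p).

Lemma sorted_step_sum : sorted ltn [seq q.1 + q.2 | q <- p].
Proof.
rewrite sorted_map; apply: sub_sorted p_step => -[x y] [x' y'].
by rewrite /step /=; lia.
Qed.

Lemma step_uniq : uniq p.
Proof. exact: map_uniq (sorted_uniq ltn_trans ltnn sorted_step_sum). Qed.

Lemma step_grid_adj : sorted grid_adj p.
Proof.
by apply: sub_sorted p_step => -[x y] [x' y']; rewrite /step /grid_adj /=; lia.
Qed.

Lemma step_ascending : ascending p.
Proof. by apply: sub_sorted p_step => -[x y] [x' y']; rewrite /step /=; lia. Qed.

End StepPaths.

(* Along such a path the sum of the coordinates increases by one in each step,*)
(* so two points of the path that differ by one step are consecutive.         *)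
Lemma mem_path_edges_step p a b : sorted step p -> step a b ->
  ((a, b) \in path_edges p) = (a \in p) && (b \in p).
Proof.
case: p => // c p; elim: p c => [|d p IHp] c cp ab.
  rewrite mem_path_edges1 !inE; apply/esym/andP => -[/eqP ac /eqP bc].
  by move: ab; rewrite ac bc /step; lia.
have dp : sorted step (d :: p) by case/andP: cp.
have cd : step c d by case/andP: cp.
have lt_d (q : point) : q \in p -> d.1 + d.2 < q.1 + q.2.
  move=> qp; have /(order_path_min ltn_trans)/allP := sorted_step_sum _ dp.
  by apply; apply/mapP; exists q.
rewrite mem_path_edges_cons IHp // !inE !xpair_eqE.
have sum_ab : b.1 + b.2 = (a.1 + a.2).+1 by move: ab; rewrite /step; lia.
have sum_cd : d.1 + d.2 = (c.1 + c.2).+1 by move: cd; rewrite /step; lia.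
have [a_c|ac] := eqVneq a c; last first.
  have [b_c|bc] := eqVneq b c; last by rewrite /= andbF.
  subst b; have -> : (a == d) = false by apply/eqP => ad; subst a; lia.
  have -> : (a \in p) = false by apply/negP => /lt_d; lia.
  by [].
subst a.
have -> : (c == d) = false by apply/eqP => ad; subst c; lia.
have -> : (c \in p) = false by apply/negP => /lt_d; lia.
have -> : (b == c) = false by apply/eqP => bc; subst b; lia.
have -> : (b \in p) = false by apply/negP => /lt_d; lia.
by rewrite !orbF.
Qed.

(** Each run starts one past the preceding corner, so that corners are not repeated. *)
Definition staircase l row r d col u : seq point :=
  (l, row) :: hrun row l.+1 (r - l) ++ vrun r row.+1 (d - row)
    ++ hrun d r.+1 (col - r) ++ vrun col d.+1 (u - d).

Section Staircase.

Variables l row r d col u : nat.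
Hypotheses (lr : l < r) (rowd : row < d) (rcol : r < col) (du : d < u).

Let S := staircase l row r d col u.

Lemma staircase_step : sorted step S.
Proof.
rewrite /= !cat_path path_hrun last_hrun (subnKC (ltnW lr)) path_vrun last_vrun.
rewrite (subnKC (ltnW rowd)) path_hrun last_hrun (subnKC (ltnW rcol)).
exact: path_vrun.
Qed.

Lemma bends_staircase : bends S <= 3.
Proof.
apply: leq_trans (bends_cat _ _ _) _; rewrite last_hrun (subnKC (ltnW lr)).
rewrite [bends _](bends_hrun row l (r - l).+1) ltnS.
apply: leq_trans (bends_cat _ _ _) _; rewrite last_vrun (subnKC (ltnW rowd)).
rewrite [bends _](bends_vrun r row (d - row).+1) ltnS.
apply: leq_trans (bends_cat _ _ _) _; rewrite last_hrun (subnKC (ltnW rcol)).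
rewrite [bends _](bends_hrun d r (col - r).+1) ltnS.
by rewrite [bends _](bends_vrun col d (u - d).+1).
Qed.

Lemma mem_staircase p : p \in S =
  [|| (p.2 == row) && (l <= p.1 <= r), (p.1 == r) && (row <= p.2 <= d),
      (p.2 == d) && (r <= p.1 <= col) | (p.1 == col) && (d <= p.2 <= u)].
Proof.
case: p => x y; rewrite inE !mem_cat !mem_hrun !mem_vrun xpair_eqE /=; lia.
Qed.

Lemma hedge_staircase x y :
  hedge S x y = (y == row) && (l <= x < r) || (y == d) && (r <= x < col).
Proof.
rewrite /hedge mem_path_edges_step ?staircase_step //; last by rewrite /step /= !eqxx.
by rewrite !mem_staircase /=; lia.
Qed.

Lemma vedge_staircase x y :
  vedge S x y = (x == r) && (row <= y < d) || (x == col) && (d <= y < u).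
Proof.
rewrite /vedge mem_path_edges_step ?staircase_step //; last first.
  by rewrite /step /= !eqxx orbT.
by rewrite !mem_staircase /=; lia.
Qed.

Lemma staircase_path c h : col < c -> u < h -> grid_path c h S.
Proof.
move=> ltc lth; apply/and4P; split.
- rewrite /S /staircase /= size_cat size_map size_iota; lia.
- exact: step_uniq staircase_step.
- by apply/allP => -[x y]; rewrite mem_staircase /grid_point /=; lia.
- exact: step_grid_adj staircase_step.
Qed.

End Staircase.

(** * Monotonic representations from intervals *)

(** This expresses a common unit edge only for nonempty intervals: an empty one strictly inside
    another also passes the test. *)
Definition overlap (h k : nat * (nat * nat)) : bool :=
  [&& h.1 == k.1, h.2.1 < k.2.2 & k.2.1 < h.2.2].

(* The right ends [r v] and the lower ends [d v] are distinct, so the two     *)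
(* inner segments of each staircase lie on grid lines of their own.           *)
Lemma Bm3_of_distinct_ends (G : sgraph) (row l r col d u : G -> nat) :
  (forall v, l v < r v) -> (forall v, d v < u v) -> injective r -> injective d ->
  (forall v w, v != w -> adj v w =
     overlap (row v, (l v, r v)) (row w, (l w, r w))
     || overlap (col v, (d v, u v)) (col w, (d w, u w))) ->
  Bm 3 G.
Proof.
move=> lr du r_inj d_inj adjE.
have bound (f : G -> nat) v : f v < (\max_w f w).+1 by rewrite ltnS leq_bigmax.
pose X := (\max_w r w).+1; pose Y := (\max_w row w).+1.
pose P v := staircase (l v) (row v) (r v) (Y + d v) (X + col v) (Y + u v).
have rowY v : row v < Y + d v by apply: ltn_addr (bound row v).
have rX v : r v < X + col v by apply: ltn_addr (bound r v).
have Ydu v : Y + d v < Y + u v by rewrite ltn_add2l.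
exists (X + (\max_w col w).+1), (Y + (\max_w u w).+1), P; split; last first.
  move=> v; split; last exact: bends_staircase.
  by rewrite /monotonic step_ascending // staircase_step.
have Pgrid v : grid_path (X + (\max_w col w).+1) (Y + (\max_w u w).+1) (P v).
  by apply: staircase_path; rewrite // ltn_add2l bound.
split=> // v w vw; rewrite adjE //.
have := lr v; have := lr w; have := du v; have := du w.
have := rowY v; have := rowY w; have := rX v; have := rX w.
have : r v < X := bound r v; have : r w < X := bound r w.
have : row v < Y := bound row v; have : row w < Y := bound row w.
have : r v != r w by rewrite (inj_eq r_inj).
have : d v != d w by rewrite (inj_eq d_inj).
move=> dd rr rowwY rowvY rwX rvX rXw rXv rowYw rowYv duw duv lrw lrv.
apply/idP/share_edgeP => [||[x [y]]].
- by case/and4P: (Pgrid w).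
- move=> /orP[]; rewrite /overlap /=.
  + exists (maxn (l v) (l w)), (row v).
    by rewrite !hedge_staircase //; lia.
  + exists (X + col v), (Y + maxn (d v) (d w)).
    by rewrite !vedge_staircase //; lia.
(* Inner segments share no edge: the rows [Y + d v] are distinct and above every [row w], and the
   columns [r v] are distinct and left of every [X + col w]. *)
rewrite !hedge_staircase // !vedge_staircase // /overlap /=; lia.
Qed.

Lemma Bm3_of_intervals (G : sgraph) (row l r col d u : G -> nat) :
  (forall v, l v < r v) -> (forall v, d v < u v) ->
  (forall v w, v != w -> adj v w =
     overlap (row v, (l v, r v)) (row w, (l w, r w))
     || overlap (col v, (d v, u v)) (col w, (d w, u w))) ->
  Bm 3 G.
Proof.
move=> lr du adjE; pose n := #|G|; pose rk (v : G) : nat := enum_rank v.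
have rk_lt v : rk v < n := ltn_ord (enum_rank v).
have rk_inj : injective rk by move=> v w /val_inj/enum_rank_inj.
(* The residue modulo [n] recovers the rank of the vertex. *)
have mixed_inj (f : G -> nat) : injective (fun v => n * f v + rk v).
  move=> v w /(congr1 (modn^~ n)).
  by rewrite ![n * _]mulnC !modnMDl !modn_small //; apply: rk_inj.
(* Left ends get the largest offset [n.-1], so the offset [rk v] of a right end never turns touching
   intervals into overlapping ones. *)
have scale_r i j v : (n * i + n.-1 < n * j + rk v) = (i < j).
  have := rk_lt v; case: (ltnP i j) => ij; nia.
have scale_d i j v : (n * i + rk v < n * j) = (i < j).
  have := rk_lt v; case: (ltnP i j) => ij; nia.
apply: (@Bm3_of_distinct_ends G row (fun v => n * l v + n.-1)
  (fun v => n * r v + rk v) col (fun v => n * d v + rk v) (fun v => n * u v)) => //.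
- by move=> v; rewrite scale_r.
- by move=> v; rewrite scale_d.
by move=> v w vw; rewrite adjE // /overlap /= !scale_r !scale_d.
Qed.

(* An empty interval is replaced by an interval on a line of its own.         *)
Lemma nonempty_intervals (T : finType) (h : T -> nat * (nat * nat)) :
  exists line lo hi : T -> nat, (forall v, lo v < hi v) /\
  forall v w, v != w -> overlap (line v, (lo v, hi v)) (line w, (lo w, hi w)) =
    [&& overlap (h v) (h w), (h v).2.1 < (h v).2.2 & (h w).2.1 < (h w).2.2].
Proof.
pose e v := (h v).2.1 < (h v).2.2; pose M := (\max_v (h v).1).+1.
have hM v : (h v).1 < M by rewrite ltnS (leq_bigmax (F := fun v => (h v).1)).
(* [M] exceeds every line in use, and ranks keep the new lines apart. *)
exists (fun v => if e v then (h v).1 else M + enum_rank v),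
  (fun v => if e v then (h v).2.1 else 0), (fun v => if e v then (h v).2.2 else 1).
split=> [v|v w vw]; first by case: ifP.
have : enum_rank v != enum_rank w by rewrite (inj_eq enum_rank_inj).
rewrite -val_eqE /overlap /=; have := hM v; have := hM w.
by rewrite -/(e v) -/(e w); case: (e v); case: (e w) => /=; lia.
Qed.

Theorem theorem4p2 (G : sgraph) : B 1 G -> Bm 3 G.
Proof.
move=> [c [r [P [[Pgrid adjE] P1]]]].
pose edges_of v (hv : (nat * (nat * nat)) * (nat * (nat * nat))) :=
  (forall x y, hedge (P v) x y = (y == hv.1.1) && (hv.1.2.1 <= x < hv.1.2.2)) /\
  (forall x y, vedge (P v) x y = (x == hv.2.1) && (hv.2.2.1 <= y < hv.2.2.2)).
have [hv hvE] : exists hv, forall v, edges_of v (hv v).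
  apply: (@fin_all_exists _ _ edges_of) => v.
  have [h [k hk]] := one_bend_edges _ _ _ (Pgrid v) (P1 v).
  by exists (h, k).
have [row [l [r' [lr ovh]]]] := nonempty_intervals G (fun v => (hv v).1).
have [col [d [u [du ovv]]]] := nonempty_intervals G (fun v => (hv v).2).
apply: (@Bm3_of_intervals G row l r' col d u) => // v w vw.
rewrite adjE // ovh // ovv //.
have [hv_v vv_v] := hvE v; have [hv_w vv_w] := hvE w.
apply/share_edgeP/idP; first by case/and4P: (Pgrid w).
  by move=> [x [y]]; rewrite hv_v hv_w vv_v vv_w /overlap; lia.
rewrite /overlap => /orP[] ov.
  (* The common part of the two intervals begins at the larger left end. *)
  exists (maxn (hv v).1.2.1 (hv w).1.2.1), (hv v).1.1.
  by rewrite hv_v hv_w; lia.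
exists (hv v).2.1, (maxn (hv v).2.2.1 (hv w).2.2.1).
by rewrite vv_v vv_w; lia.
Qed.
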